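(* Let $q$ be a prime power and $0<1/n\ll\theta\ll\epsilon\ll1$ (implicit functions may depend on $q$). Let $H$ be a $(q+1)$-graph on a set $X$ of $n$ vertices with $d_{PG_2(q)}(H)<\theta$ such that the $q$-graph $G=\{Q\in\binom{X}{q}:|N_H(Q)|<(1/2-\theta)n\}$ has density $d(G)<\theta$. Then there is a partition $X=A\cup B$ such that at most $\epsilon n^{q+1}$ edges of $H$ are contained entirely within $A$ or entirely within $B$.
   Context: Hierarchy convention: ''$0<\alpha\ll\beta$'' means there is an increasing function $f$ such that the statement holds whenever $0<\alpha<f(\beta)$; chains are read right to left. For a $k$-graph $H$ and $S\subseteq V(H)$, $N_H(S)=\{T\subseteq V(H)\setminus S:S\cup T\in E(H)\}$. The density of a $k$-graph $G$ on $n$ vertices is $d(G)=k!|E(G)|/n^k$. $d_F(H)$ is the probability that a uniformly random map $\phi:V(F)\to V(H)$ sends every edge of $F$ to an edge of $H$. $PG_2(q)$ is the $(q+1)$-graph whose vertices are the one-dimensional subspaces of $\mathbb{F}_q^3$ and whose edges are, for each two-dimensional subspace, the set of one-dimensional subspaces it contains. *)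

(* Defs.v *)
From mathcomp Require Import all_boot all_algebra.
From Stdlib Require Import Reals.
Set Implicit Arguments. Unset Strict Implicit. Unset Printing Implicit Defensive.

Section PG.
Variable F : finFieldType.

Definition subsp (M : 'M[F]_3) : {set 'rV[F]_3} := [set w : 'rV[F]_3 | (w <= M)%MS].

Definition PGpoints : {set {set 'rV[F]_3}} :=
  [set subsp M | M : 'M[F]_3 & \rank M == 1%N].

Definition PGpt := {P : {set 'rV[F]_3} | P \in PGpoints}.

Definition PGedges : {set {set PGpt}} :=
  [set [set P : PGpt | val P \subset subsp L] | L : 'M[F]_3 & \rank L == 2%N].
End PG.

(* A hypergraph on a finite vertex type V is given by its edge set E : {set {set V}}. *)

Definition hom_count (V X : finType) (EF : {set {set V}}) (EH : {set {set X}}) : nat :=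
  #|[set f : {ffun V -> X} | [forall e in EF, (f @: e) \in EH]]|.

Definition hom_density (V X : finType) (EF : {set {set V}}) (EH : {set {set X}}) : R :=
  (INR (hom_count EF EH) / INR (expn #|X| #|V|))%R.

Definition nbhd (X : finType) (EH : {set {set X}}) (S : {set X}) : {set {set X}} :=
  [set T : {set X} | [disjoint T & S] && ((S :|: T) \in EH)].

Definition kdensity (k : nat) (X : finType) (G : {set {set X}}) : R :=
  (INR (k`! * #|G|) / INR (expn #|X| k))%R.

Definition lowdeg (X : finType) (EH : {set {set X}}) (q : nat) (theta : R) : {set {set X}} :=
  [set Q : {set X} | (#|Q| == q) &&
     (if Rlt_dec (INR #|nbhd EH Q|) ((1/2 - theta) * INR #|X|)%R then true else false)].

Definition inside_edges (X : finType) (EH : {set {set X}}) (A : {set X}) : {set {set X}} :=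
  [set e in EH | (e \subset A) || (e \subset ~: A)].

(* Main.v *)
Require Import Defs.
From mathcomp Require Import all_boot all_order all_algebra.
From mathcomp Require Import ring lra zify.
From mathcomp Require Import boolp Rstruct.

(** For a set [V] of vertices call [z] rich for [V] if a positive proportion of the maps
  [u : F -> V] have [z |: u(F)] in [H]; by the codegree condition about half of all
  vertices, or more, are rich for [V].  A projective plane is a point [z], [q + 1] disjoint
  [q]-sets completing to the lines through [z], and [q ^ 2] further lines, each
  meeting every [q]-set once.  If [H] is dense on [W_0 x ... x W_q], it has a sub-box on
  which all its large sub-boxes are dense; there the [q ^ 2] transversal lines can be counted
  one by one even when the [q]-sets are prescribed to lie in the link of [z].  As [H] has few
  planes, almost no [z] is rich for all of [W_0, ..., W_q].

  Take [V] whose rich set [S] essentially does not shrink when [V] is replaced by a large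
  subset.  For [U] inside [S] the box [U x V x ... x V] is dense, so [U] has a large subset
  whose rich set is almost disjoint from [S], hence is almost the complement [T] of [S], and
  both have size about [n / 2].  The same argument with such a subset in place of [V] shows
  that sets inside [T] have large subsets with rich set almost [S].  If many edges were inside
  [S], a dense box inside [S] could be shrunk so that almost all of [T] is rich for all its
  sides, a contradiction; likewise for [T]. *)

Set Implicit Arguments. Unset Strict Implicit. Unset Printing Implicit Defensive.
Import Order.TTheory GRing.Theory Num.Theory.

(** * Boxes *)

Section Boxes.
Local Open Scope ring_scope.
Variables (R : archiRealFieldType) (I X : finType) (h : pred {ffun I -> X}).
Implicit Types (V W A : I -> {set X}).

Definition vol V : R := \prod_i #|V i|%:R.

Definition ecount V : R := #|[pred w in family V | h w]|%:R.

Lemma card_box V : #|family V|%:R = vol V.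
Proof.
rewrite card_family foldrE big_map big_enum /= natr_prod.
by apply: eq_bigr => i _; rewrite cardE.
Qed.

Lemma vol_ge0 V : 0 <= vol V.
Proof. by apply: prodr_ge0. Qed.

Lemma ecount_ge0 V : 0 <= ecount V.
Proof. exact: ler0n. Qed.

Lemma ecount_le_vol V : ecount V <= vol V.
Proof.
by rewrite -card_box ler_nat; apply: subset_leq_card; apply/subsetP => w /andP[].
Qed.

(** One-sided regularity: the error is measured against the whole box, so only sub-boxes filling
    more than a proportion [eta / d] of [V] are constrained. *)
Definition good (d eta : R) V :=
  forall A, (forall i, A i \subset V i) ->
  d * vol A - eta * vol V <= ecount A.

Definition cell V A (s : {ffun I -> bool}) i := if s i then A i else V i :\: A i.

Lemma card_cells (P : pred {ffun I -> X}) V A : (forall i, A i \subset V i) ->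
  #|[pred w in family V | P w]|%:R
  = \sum_s #|[pred w in family (cell V A s) | P w]|%:R :> R.
Proof.
move=> sAV; rewrite -natr_sum; congr (_%:R).
rewrite -sum1_card (partition_big (fun w : {ffun I -> X} => [ffun i => w i \in A i]) predT) //=.
apply: eq_bigr => s _; rewrite -sum1_card; apply: eq_bigl => w.
rewrite !inE -andbA [P w && _]andbC andbA; congr (_ && _).
apply/andP/familyP => [[/familyP wV /eqP <-] i|wc].
  rewrite /cell ffunE; case: ifP => // wA; by rewrite inE wA wV.
split.
  apply/familyP => i; move: (wc i); rewrite /cell; case: ifP => _; last by case/setDP.
  exact: (subsetP (sAV i)).
apply/eqP/ffunP => i; rewrite ffunE; move: (wc i); rewrite /cell.
by case: ifP => _; rewrite // !inE => /andP[/negbTE].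
Qed.

Lemma vol_cells V A : (forall i, A i \subset V i) ->
  vol V = \sum_s vol (cell V A s).
Proof.
move=> sAV; have := card_cells predT sAV.
have E W : #|[pred w in family W | predT w]| = #|family W|.
  by apply: eq_card => w; rewrite !inE andbT.
rewrite E card_box => ->; apply: eq_bigr => s _; by rewrite E card_box.
Qed.

Lemma ecount_cells V A : (forall i, A i \subset V i) ->
  ecount V = \sum_s ecount (cell V A s).
Proof. exact: card_cells. Qed.

Lemma vol_small V W nu i : (forall i, W i \subset V i) -> 0 <= nu ->
  #|W i|%:R < nu * #|V i|%:R -> vol W <= nu * vol V.
Proof.
move=> sWV nu0 lt_i; rewrite /vol (bigD1 i) //= [X in _ <= _ * X](bigD1 i) //= mulrA.
apply: ler_pM => //; [by apply: prodr_ge0 | exact: ltW |].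
apply: ler_prod => j _; rewrite ler0n ler_nat; exact: subset_leq_card.
Qed.

(** A sub-box [A] violating [good] cuts [V] into [2 ^ #|I|] cells. As [A] has too few edges, the
    other cells have more than their share. Cells with a thin side have negligible volume, so some
    cell with all sides large is denser than [d'] by [eta / 4]. *)
Lemma density_increment d d' eta V : 0 <= d -> 0 < eta -> d <= d' ->
  d' * vol V <= ecount V -> ~ good d eta V ->
  exists W, [/\ forall i, W i \subset V i,
    forall i, eta / (4 * (2 ^ #|I|)%:R) * #|V i|%:R <= #|W i|%:R &
    (d' + eta / 4) * vol W <= ecount W].
Proof.
move=> d0 eta0 dd' dV ngood.
set nu := eta / _.
have K0 : 0 < (2 ^ #|I|)%:R :> R by rewrite ltr0n expn_gt0.
have nu0 : 0 < nu by rewrite /nu divr_gt0 // mulr_gt0.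
have : exists A : {ffun I -> {set X}}, [forall i, A i \subset V i] &&
    (ecount A < d * vol A - eta * vol V).
  apply/existsP; apply: contra_notT ngood => /existsPn nA A sAV.
  have := nA [ffun i => A i]; rewrite negb_and -leNgt.
  have eA : [ffun i => A i] =1 A by move=> i; rewrite ffunE.
  have -> : vol [ffun i => A i] = vol A by apply: eq_bigr => i _; rewrite eA.
  have -> : ecount [ffun i => A i] = ecount A.
    congr (_%:R); apply: eq_card => w; rewrite !inE; congr (_ && _).
    by apply/familyP/familyP => H i; have := H i; rewrite eA.
  case/orP => // /forallPn[i]; by rewrite eA sAV.
case=> A /andP[/forallP sAV ltA].
pose s1 : {ffun I -> bool} := [ffun => true].
have c1 : cell V A s1 =1 A by move=> i; rewrite /cell ffunE.
have vc1 : vol (cell V A s1) = vol A by apply: eq_bigr => i _; rewrite c1.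
have ec1 : ecount (cell V A s1) = ecount A.
  congr (_%:R); apply: eq_card => w; rewrite !inE; congr (_ && _).
  by apply/familyP/familyP => H i; have := H i; rewrite c1.
have sCV s i : cell V A s i \subset V i.
  by rewrite /cell; case: ifP => // _; rewrite subsetDl.
have [/existsP[s /and3P[_ /forallP ? ?]]|/existsPn none] := boolP [exists s, [&& s != s1,
  [forall i, nu * #|V i|%:R <= #|cell V A s i|%:R] &
  (d' + eta / 4) * vol (cell V A s) <= ecount (cell V A s)]].
  by exists (cell V A s).
have leAV : vol A <= vol V.
  by apply: ler_prod => i _; rewrite ler0n ler_nat subset_leq_card.
have vA0 := vol_ge0 A; have eA0 := ecount_ge0 A.
have vV0 : 0 < vol V.
  rewrite lt_def vol_ge0 andbT; apply/eqP => v0; move: (ltA) (leAV); rewrite v0 => lt0 le0.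
  have vA00 : vol A = 0 by lra.
  by move: lt0; rewrite vA00; lra.
have bound s : s != s1 ->
    ecount (cell V A s) <= (d' + eta / 4) * vol (cell V A s) + nu * vol V.
  have v0 := vol_ge0 (cell V A s).
  move=> ns; have := none s; rewrite ns /= negb_and -ltNge => /orP[/forallPn[i]|lt_e].
    rewrite -ltNge => small; have := vol_small (sCV s) (ltW nu0) small => le_v.
    have ev := ecount_le_vol (cell V A s).
    apply: (le_trans ev); apply: (le_trans le_v).
    by rewrite lerDr mulr_ge0 //; lra.
  by rewrite ltW // ltr_wpDr // mulr_ge0 //; apply: ltW.
have := ecount_cells sAV; rewrite (bigD1 s1) //= ec1 => eV.
have := vol_cells sAV; rewrite (bigD1 s1) //= vc1 => vV.
have : \sum_(s | s != s1) ecount (cell V A s) <=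
    (d' + eta / 4) * (vol V - vol A) + eta / 4 * vol V.
  apply: (le_trans (ler_sum _ bound)).
  rewrite big_split /= -mulr_sumr.
  have -> : \sum_(s | s != s1) vol (cell V A s) = vol V - vol A by rewrite vV addrAC subrr add0r.
  rewrite lerD2l.
  rewrite sumr_const -[_ *+ _]mulr_natl mulrA ler_wpM2r ?(ltW vV0) //.
  apply: (@le_trans _ _ ((2 ^ #|I|)%:R * nu)).
    rewrite ler_wpM2r ?(ltW nu0) // ler_nat.
    by rewrite (leq_trans (max_card _)) // card_ffun card_bool.
  by rewrite le_eqVlt; apply/orP; left; apply/eqP; rewrite /nu; field; rewrite gt_eqF.
(* [A] falls short of density [d'] by more than [eta * vol V], while the other cells together exceed
   it by at most half of that, so [V] cannot have density [d']. *)
have h1 : 0 <= (d' - d) * vol A by rewrite mulr_ge0 // subr_ge0.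
have h2 : 0 <= eta * vol A by rewrite mulr_ge0 // ltW.
have h3 : 0 < eta * vol V by rewrite mulr_gt0.
by move: eV ltA dV; lra.
Qed.

End Boxes.

Section GoodSubbox.
Local Open Scope ring_scope.
(** Density increments of [eta / 4] can be repeated only boundedly often, since no density exceeds
    1; each one shrinks the sides by a fixed factor. *)
Lemma good_subbox (R : archiRealFieldType) (I : finType) (d eta : R) : 0 <= d -> 0 < eta <= 1 ->
  exists2 nu : R, 0 < nu <= 1 & forall (X : finType) (h : pred {ffun I -> X}) V,
  d * vol R V <= ecount R h V ->
  exists W : I -> {set X}, [/\ forall i, W i \subset V i,
    forall i, nu * #|V i|%:R <= #|W i|%:R & good h d eta W].
Proof.
move=> d0 /andP[eta0 eta1].
set nu := eta / (4 * (2 ^ #|I|)%:R).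
have K1 : 1 <= (2 ^ #|I|)%:R :> R by rewrite ler1n expn_gt0.
have nu0 : 0 < nu by rewrite /nu divr_gt0 //; lra.
have nu1 : nu <= 1 by rewrite /nu ler_pdivrMr; lra.
(* [m] bounds the increments still possible from density [d']; at [m = 0] the density would exceed
   1, which forces volume 0. *)
have step m : forall (X : finType) (h : pred {ffun I -> X}) d' V,
    d <= d' -> 1 < d' + m%:R * (eta / 4) ->
    d' * vol R V <= ecount R h V ->
    exists W : I -> {set X}, [/\ forall i, W i \subset V i,
      forall i, nu ^+ m * #|V i|%:R <= #|W i|%:R & good h d eta W].
  elim: m => [|m IHm] X h d' V dd' big dV.
    exists V; split=> // [i|A sAV]; first by rewrite mul1r.
    have v0 : vol R V = 0.
      apply/eqP; rewrite eq_le vol_ge0 andbT.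
      have := ecount_le_vol R h V; have := vol_ge0 R V; nra.
    have : vol R A <= vol R V by apply: ler_prod => i _; rewrite ler0n ler_nat subset_leq_card.
    have := vol_ge0 R A; rewrite v0 => *.
    have -> : vol R A = 0 by lra.
    by rewrite !mulr0 subrr ecount_ge0.
  have [gV|/(density_increment d0 eta0 dd' dV)[W [sWV szW dW]]] := pselect (good h d eta V).
    exists V; split=> // i.
    by rewrite ler_piMl // exprn_ile1 // ltW.
  have [||W' [sW'W szW' gW']] := IHm _ _ _ _ _ _ dW.
  - by lra.
  - by move: big; rewrite -natr1; lra.
  exists W'; split=> // i; first exact: subset_trans (sW'W i) (sWV i).
  rewrite exprSr -mulrA; apply: le_trans (szW' i).
  by rewrite ler_wpM2l ?exprn_ge0 ?szW // ltW.
pose m := Num.bound (4 / eta).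
exists (nu ^+ m); first by rewrite exprn_gt0 // exprn_ile1 // ltW.
move=> X h V; apply: step => //.
have : 4 / eta < m%:R by rewrite archi_boundP // divr_ge0 // ltW.
rewrite ltr_pdivrMr // => ?; lra.
Qed.
End GoodSubbox.

(** * Counting transversal lines *)

Section TransversalCount.
Local Open Scope ring_scope.
Variables (R : archiRealFieldType) (I J L X : finType) (i0 : I).
Variables (h : pred {ffun I -> X}) (pt : L -> I -> J).
Hypothesis pt_linear : forall l l' i j, l != l' ->
  pt l i = pt l' i -> pt l j = pt l' j -> i = j.
Variables (d eta : R) (V : I -> {set X}) (P : I -> pred {ffun J -> X}).
Hypotheses (d0 : 0 <= d) (d1 : d <= 1) (eta0 : 0 <= eta).
Hypothesis gV : good h d eta V.
Hypothesis volV : 0 < vol R V.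
Hypothesis PV : forall i u, P i u -> forall s, u s \in V i.

Local Notation fam := {ffun I -> {ffun J -> X}}.

(** A [fam] places each point [s] of each group [i] at the vertex [v i s]; a line [l] meets group
    [i] in the single point [pt l i]. *)
Definition along (v : fam) l : {ffun I -> X} := [ffun i => v i (pt l i)].

Definition upd (v : fam) l (w : {ffun I -> X}) : fam :=
  [ffun i => [ffun s => if s == pt l i then w i else v i s]].

Definition linked (ls : seq L) : pred fam :=
  [pred v | (v \in family P) && all (fun l => h (along v l)) ls].

Definition inV : pred fam := [pred v : fam | [forall i, forall s, v i s \in V i]].

Lemma along_upd v l w : along (upd v l w) l = w.
Proof. by apply/ffunP => i; rewrite !ffunE eqxx. Qed.

Lemma upd_along v l w : upd (upd v l w) l (along v l) = v.
Proof.
by apply/ffunP => i; apply/ffunP => s; rewrite !ffunE; case: eqP => // ->.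
Qed.

Lemma linked_inV ls v : linked ls v -> inV v.
Proof.
case/andP => /familyP Pv _; apply/forallP => i; apply/forallP => s.
by apply: (PV (i := i)); apply: Pv.
Qed.

Lemma upd_inV v l w : inV v -> w \in family V -> inV (upd v l w).
Proof.
move=> /forallP vV /familyP wV; apply/forallP => i; apply/forallP => s.
by rewrite !ffunE; case: ifP => // _; move/forallP: (vV i).
Qed.

Lemma along_inV v l : inV v -> along v l \in family V.
Proof.
by move=> /forallP vV; apply/familyP => i; rewrite ffunE; move/forallP: (vV i).
Qed.

(* Swapping the points of [v] on the line [l] with [w] is an involution of the pairs [(v, w)]. *)
Lemma swap_count l (Q : pred fam) : (forall v, Q v -> inV v) ->
  \sum_(v | inV v) #|[pred w in family V | Q (upd v l w)]|%:R
  = vol R V * #|Q|%:R.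
Proof.
move=> QV; pose f (p : fam * {ffun I -> X}) := (upd p.1 l p.2, along p.1 l).
have fK : involutive f by case=> v w; rewrite /f /= along_upd upd_along.
rewrite mulrC -card_box -natrM -cardX -natr_sum; congr (_%:R).
under eq_bigr do rewrite -sum1_card.
rewrite pair_big_dep /= -sum1_card [LHS](reindex_inj (inv_inj fK)) /=.
apply: eq_bigl => -[v w]; rewrite !inE /= upd_along -[v \in Q]/(Q v).
apply/idP/idP.
  case/and3P => uV _ Qv; apply/andP; split=> //.
  by have := along_inV l uV; rewrite along_upd inE.
case/andP=> Qv wV; have vV := QV v Qv; apply/and3P; split=> //.
  by apply: upd_inV => //; rewrite inE.
by have := along_inV l vV; rewrite inE.
Qed.

Lemma card_inV : #|inV|%:R = vol R V ^+ #|J|.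
Proof.
have -> : #|inV| = #|family (fun i => ffun_on (mem (V i)) : {pred {ffun J -> X}})|.
  apply: eq_card => v; apply/forallP/familyP => H i.
    by apply/ffun_onP => s; move/forallP: (H i).
  by apply/forallP => s; move/ffun_onP: (H i).
rewrite card_family foldrE big_map big_enum /= natr_prod -prodrXl.
by apply: eq_bigr => i _; rewrite card_ffun_on natrX.
Qed.

(** Each constraint sees at most one coordinate of [w]: [P i] sees only [w i], and another line
    meets [l] in at most one point. Hence the admissible [w] form a box, and each coordinate may be
    checked with its own witness. *)
Lemma linked_upd_eq ls v l (w : {ffun I -> X}) : l \notin (ls : seq L) ->
  (forall i, exists2 w' : {ffun I -> X}, w' i = w i & linked ls (upd v l w')) ->
  linked ls (upd v l w).
Proof.
move=> lls H; apply/andP; split.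
  apply/familyP => j; have [w' ww' /andP[/familyP/(_ j) + _]] := H j.
  by rewrite !ffunE ww'.
apply/allP => l' l'ls; have ll' : l != l' by apply: contraNneq lls => ->.
have [w' hw' eq_w] : exists2 w', linked ls (upd v l w') &
    along (upd v l w') l' = along (upd v l w) l'.
  have [j /eqP jl|nol] := pickP (fun j => pt l' j == pt l j).
    have [w' ww' tr] := H j; exists w' => //; apply/ffunP => i'; rewrite !ffunE.
    case: eqP => // il.
    by rewrite (@pt_linear l l' i' j ll' (esym il) (esym jl)).
  have [w' _ tr] := H i0; exists w' => //; apply/ffunP => i'; rewrite !ffunE nol //.
by case/andP: hw' => _ /allP/(_ _ l'ls); rewrite /= eq_w.
Qed.

(** Fix the points off [l]. The positions on [l] respecting the earlier constraints form a sub-box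
    of [V], to which [good] applies; [swap_count] sums this over all placements. One more line costs
    a factor [d] and an error [eta]. *)
Lemma linked_step l ls : l \notin ls ->
  d * #|linked ls|%:R - eta * vol R V ^+ #|J| <= #|linked (l :: ls)|%:R.
Proof.
move=> lls; rewrite -(ler_pM2l volV).
rewrite -(swap_count l (@linked_inV (l :: ls))).
have -> : vol R V * (d * #|linked ls|%:R - eta * vol R V ^+ #|J|) =
  \sum_(v | inV v) (d * #|[pred w in family V | linked ls (upd v l w)]|%:R - eta * vol R V).
  have cI : \sum_(v | inV v) (eta * vol R V) = vol R V ^+ #|J| * (eta * vol R V).
    by rewrite sumr_const -[LHS]mulr_natl; congr (_ * _); apply: card_inV.
  by rewrite sumrB -mulr_sumr (swap_count l (@linked_inV ls)) cI; ring.
apply: ler_sum => v vV.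
pose A i := [set x in V i | [exists w : {ffun I -> X}, (w i == x) && linked ls (upd v l w)]].
have sAV i : A i \subset V i by apply/subsetP => x; rewrite inE => /andP[].
have EA w : (w \in family V) && linked ls (upd v l w) = (w \in family A).
  apply/andP/familyP => [[/familyP wV tr] i|wA].
    by rewrite inE wV; apply/existsP; exists w; rewrite eqxx.
  have wV : w \in family V by apply/familyP => i; apply: (subsetP (sAV i)); apply: wA.
  split=> //; apply: linked_upd_eq => // i.
  have := wA i; rewrite inE => /andP[_ /existsP[w' /andP[/eqP ? ?]]].
  by exists w'.
have := gV sAV; rewrite -(card_box R A).
have -> : #|family A| = #|[pred w in family V | linked ls (upd v l w)]|.
  by apply: eq_card => w; rewrite !inE EA.
move/le_trans; apply; rewrite ler_nat; apply: subset_leq_card.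
apply/subsetP => w /andP[]; rewrite -EA => /andP[wV /andP[Pw al]] hw.
by rewrite inE wV /linked /= along_upd hw Pw.
Qed.

Lemma linked_count ls : uniq ls ->
  d ^+ size ls * \prod_i #|P i|%:R - (size ls)%:R * eta * vol R V ^+ #|J|
  <= #|linked ls|%:R.
Proof.
elim: ls => [_|l ls IHls /= /andP[lls /IHls le_ls]].
  rewrite mul1r !mul0r subr0.
  rewrite -natr_prod ler_nat; apply: eq_leq.
  have -> : #|linked [::]| = #|family P| by apply: eq_card => v; rewrite !inE andbT.
  by rewrite card_family foldrE big_map big_enum.
apply: le_trans (linked_step lls).
have v0 : 0 <= eta * vol R V ^+ #|J| by rewrite mulr_ge0 // exprn_ge0 // ltW.
have s0 : 0 <= (size ls)%:R * (eta * vol R V ^+ #|J|) by rewrite mulr_ge0.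
have := ler_wpM2l d0 le_ls; rewrite exprS -natr1.
have : d * ((size ls)%:R * (eta * vol R V ^+ #|J|)) <= (size ls)%:R * (eta * vol R V ^+ #|J|).
  by rewrite ler_piMl.
rewrite !mulrBr !mulrDl !mulrA !mul1r; lra.
Qed.

End TransversalCount.

(** * Coordinates on the projective plane *)

Section PlaneCoordinates.
Local Open Scope ring_scope.
Variable F : finFieldType.

Definition row3 (a b c : F) : 'rV[F]_3 := \row_(j < 3) [:: a; b; c]`_j.

Lemma row3E (w : 'rV[F]_3) : exists a b c, w = row3 a b c.
Proof.
exists (w 0 0), (w 0 1), (w 0 2%:R); apply/rowP => j; rewrite mxE.
by case: j => [[|[|[|]]]] //= ?; congr (w _ _); apply: val_inj.
Qed.

Lemma row3_inj a b c a' b' c' : row3 a b c = row3 a' b' c' -> [/\ a = a', b = b' & c = c'].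
Proof.
move=> /rowP e; have := (e 0, e 1, e 2%:R).
by rewrite !mxE => -[[]].
Qed.

Lemma scale_row3 x a b c : x *: row3 a b c = row3 (x * a) (x * b) (x * c).
Proof. by apply/rowP => -[[|[|[|]]]] //= ?; rewrite !mxE. Qed.

Lemma row3_eq0 a b c : (row3 a b c == 0) = [&& a == 0, b == 0 & c == 0].
Proof.
have r0 : row3 0 0 0 = 0 by apply/rowP => -[[|[|[|]]]] //= ?; rewrite !mxE.
apply/eqP/and3P => [|[/eqP-> /eqP-> /eqP->] //].
by rewrite -r0 => /row3_inj[-> -> ->].
Qed.

Lemma dot_row3 a b c a' b' c' :
  (row3 a b c *m (row3 a' b' c')^T == 0) = (a' * a + b' * b + c' * c == 0).
Proof.
have -> : row3 a b c *m (row3 a' b' c')^T = (a' * a + b' * b + c' * c)%:M.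
  apply/matrixP => i j; rewrite !ord1 !mxE /= !big_ord_recl big_ord0 !mxE /=.
  by rewrite mulr1n; ring.
by apply/eqP/eqP => [/matrixP/(_ 0 0)|->]; rewrite ?raddf0 // !mxE mulr1n.
Qed.

(** The coefficients are a normal vector: a non-zero row of the kernel of [L^T]. Its orthogonal
    space contains [L] and has the same rank. *)
Lemma line_equation (L : 'M[F]_3) : \rank L = 2%N ->
  exists a' b' c', row3 a' b' c' != 0 /\
    forall a b c, (row3 a b c <= L)%MS = (a' * a + b' * b + c' * c == 0).
Proof.
move=> rL; have [a' [b' [c' Ec]]] := row3E (nz_row (kermx L^T)).
exists a', b', c'; rewrite -Ec; have nz : nz_row (kermx L^T) != 0.
  by rewrite nz_row_eq0 -mxrank_eq0 mxrank_ker mxrank_tr rL.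
split=> // a b c; rewrite -dot_row3 -Ec -sub_kermx.
set v := nz_row _ in nz *.
have sL : (L <= kermx v^T)%MS.
  apply/sub_kermxP/trmx_inj; rewrite trmx_mul trmxK trmx0.
  by apply/sub_kermxP; apply: nz_row_sub.
have : (L == kermx v^T)%MS.
  rewrite -(mxrank_leqif_eq sL) rL mxrank_ker mxrank_tr rank_rV nz //.
by move/eqmxP => ->.
Qed.

(* The plane as one point at infinity [None] together with a point [s] of each
   of the [q + 1] groups indexed by the lines [i] through [None]. *)
Definition model := option (option F * F).

(** Homogeneous coordinates with first non-zero entry 1. The first two entries determine the group,
    because [None] is the point (0 : 0 : 1). *)
Definition coords (m : model) : 'rV[F]_3 :=
  match m with
  | None => row3 0 0 1
  | Some (None, s) => row3 0 1 s
  | Some (Some a, s) => row3 1 a s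
  end.

Lemma coords_neq0 m : coords m != 0.
Proof. by case: m => [[[a|] s]|]; rewrite row3_eq0 oner_eq0 ?andbF. Qed.

Lemma coords_sub_inj m m' : (coords m <= coords m')%MS -> m = m'.
Proof.
case/sub_rVP => x; case: m => [[[a|] s]|]; case: m' => [[[a'|] s']|] /=;
  rewrite scale_row3 => /row3_inj[]; rewrite ?mulr0 ?mulr1 => //.
- by move=> <-; rewrite !mul1r => -> ->.
- by move/eqP; rewrite oner_eq0.
- by move/eqP; rewrite oner_eq0.
- by move=> <-; rewrite !mul0r => /eqP; rewrite oner_eq0.
- by move=> _ <-; rewrite !mul1r => ->.
- by move=> _ /eqP; rewrite oner_eq0.
- by move=> <-; rewrite !mul0r => _ /eqP; rewrite oner_eq0.
- by move=> _ <-; rewrite !mul0r => /eqP; rewrite oner_eq0.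
Qed.

Lemma coords_surj (w : 'rV[F]_3) : w != 0 -> exists m, (w :=: coords m)%MS.
Proof.
have [a [b [c ->]]] := row3E w; rewrite row3_eq0 => nz.
have [a0|a0] := eqVneq a 0; last first.
  exists (Some (Some (a^-1 * b), a^-1 * c)) => /=.
  have -> : row3 1 (a^-1 * b) (a^-1 * c) = a^-1 *: row3 a b c by rewrite scale_row3 mulVf.
  by apply: eqmx_sym; apply: eqmx_scale; rewrite invr_eq0.
have [b0|b0] := eqVneq b 0; last first.
  exists (Some (None, b^-1 * c)) => /=.
  have -> : row3 0 1 (b^-1 * c) = b^-1 *: row3 a b c by rewrite scale_row3 mulVf // a0 mulr0.
  by apply: eqmx_sym; apply: eqmx_scale; rewrite invr_eq0.
have c0 : c != 0 by move: nz; rewrite a0 b0 eqxx.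
exists None => /=.
have -> : row3 0 0 1 = c^-1 *: row3 a b c by rewrite scale_row3 mulVf // a0 b0 !mulr0.
by apply: eqmx_sym; apply: eqmx_scale; rewrite invr_eq0.
Qed.

Lemma subsp_genmx_point m : subsp <<coords m>>%MS \in PGpoints F.
Proof. by apply/imsetP; exists <<coords m>>%MS; rewrite // inE genmxE rank_rV coords_neq0. Qed.

Definition point_of (m : model) : PGpt F :=
  exist (fun P => P \in PGpoints F) _ (subsp_genmx_point m).

Lemma val_point_of m L : (val (point_of m) \subset subsp L) = (coords m <= L)%MS.
Proof.
apply/subsetP/idP => [|sL w]; last by rewrite !inE genmxE => /submx_trans; apply.
by move=> /(_ (coords m)); rewrite !inE genmxE submx_refl => /(_ isT).
Qed.

Lemma point_of_inj : injective point_of.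
Proof.
move=> m m' e; apply: coords_sub_inj.
by have := subxx (val (point_of m)); rewrite {2}e val_point_of genmxE.
Qed.

Lemma point_of_surj p : exists m, point_of m = p.
Proof.
case: p => P PP; have /imsetP[M] := PP; rewrite inE => rM EP.
have nzM : nz_row M != 0 by rewrite nz_row_eq0 -mxrank_eq0 (eqP rM).
have [m em] := coords_surj nzM; exists m; apply: val_inj; rewrite /= EP.
apply/setP => w; rewrite !inE genmxE -em.
have : (nz_row M == M)%MS.
  by rewrite -(mxrank_leqif_eq (nz_row_sub M)) rank_rV nzM (eqP rM).
by move/eqmxP => ->.
Qed.

(** The inverse of [point_of], found by search; the default is never reached, by surjectivity. *)
Definition model_of (p : PGpt F) : model := odflt None [pick m | point_of m == p].

Lemma point_ofK : cancel point_of model_of.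
Proof.
move=> m; rewrite /model_of; case: pickP => [m' /eqP/point_of_inj //|/(_ m)].
by rewrite eqxx.
Qed.

Lemma model_ofK : cancel model_of point_of.
Proof. by move=> p; have [m <-] := point_of_surj p; rewrite point_ofK. Qed.

Lemma card_PGpt : #|{: PGpt F}| = (#|F|.+1 * #|F|).+1.
Proof.
by rewrite (bij_eq_card (Bijective model_ofK point_ofK)) !card_option card_prod card_option.
Qed.

(** The line with equation z = l.1 x + l.2 y, evaluated at (1, a) or at (0, 1). *)
Definition slope (l : F * F) (i : option F) : F :=
  if i is Some a then l.1 + l.2 * a else l.2.

Lemma slope_linear l l' i j : l != l' ->
  slope l i = slope l' i -> slope l j = slope l' j -> i = j.
Proof.
case: l l' => x y [x' y'] ne.
have same_y a : y = y' -> x + y * a = x' + y' * a -> False.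
  by move=> ey; rewrite ey => /addIr ex; move: ne; rewrite ex ey eqxx.
case: i j => [a|] [b|] //= e1 e2; [|by case: (same_y a)|by case: (same_y b)].
congr Some; apply/eqP; rewrite -subr_eq0; apply/negPn/negP => ab.
have : (y - y') * (a - b) = 0.
  have -> : (y - y') * (a - b) = (x + y * a - (x' + y' * a)) - (x + y * b - (x' + y' * b)) by ring.
  by rewrite e1 e2 !subrr.
move/eqP; rewrite mulf_eq0 (negbTE ab) orbF subr_eq0 => /eqP ey; exact: (same_y a ey e1).
Qed.

Lemma PGedge_model e : e \in PGedges F ->
  (exists i, e = point_of @: (None |: [set Some (i, s) | s : F])) \/
  (exists l, e = point_of @: [set Some (i, slope l i) | i : option F]).
Proof.
case/imsetP => L; rewrite inE => /eqP /line_equation[x [y [z [nz lE]]]] ->.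
have red (A : {set model}) : (forall m, (coords m <= L)%MS = (m \in A)) ->
    [set P : PGpt F | val P \subset subsp L] = point_of @: A.
  move=> EA; apply/setP => p; rewrite inE; have [m <-] := point_of_surj p.
  by rewrite val_point_of mem_imset //; apply: point_of_inj.
have inSome (i : option F) s j : (Some (i, s) \in [set Some (j, t) | t : F]) = (i == j).
  by apply/imsetP/eqP => [[t _ [-> _]]|->] //; exists s.
have inSlope l (i : option F) s :
    (Some (i, s) \in [set Some (j, slope l j) | j : option F]) = (s == slope l i).
  by apply/imsetP/eqP => [[t _ [-> ->]]|->] //; exists i.
have noNone l : (None \in [set Some (j, slope l j) | j : option F]) = false.
  by apply/imsetP => -[].
(* The line passes through (0 : 0 : 1) exactly when [z = 0]; then it is one group with [None] added.
   Otherwise its equation can be solved for the third coordinate. *)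
have [z0|z0] := eqVneq z 0.
  left; move: nz; rewrite row3_eq0 z0 eqxx andbT negb_and => nz.
  have [y0|y0] := eqVneq y 0.
    exists None; apply: red => -[[[a|] s]|] /=; rewrite lE !inE ?inSome y0 z0
      ?mul0r ?mulr0 ?mulr1 ?addr0 ?eqxx //.
    by move: nz; rewrite y0 eqxx orbF => /negbTE.
  exists (Some (- x / y)); apply: red => -[[[a|] s]|] /=; rewrite lE !inE ?inSome z0
    ?mul0r ?mulr0 ?mulr1 ?addr0 ?add0r ?eqxx //.
    rewrite addrC addr_eq0.
    apply/eqP/eqP => [E|[->]].
      by congr Some; rewrite -E; field.
    by field.
  exact: negbTE.
right; exists (- x / z, - y / z); apply: red => -[[[a|] s]|] /=; rewrite lE
  ?inSlope ?noNone /= ?mulr0 ?mulr1 ?addr0 ?add0r.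
- apply/eqP/eqP => [E|->]; last by field.
  have -> : s = (x + y * a + z * s) / z - (x + y * a) / z by field.
  by rewrite E; field.
- apply/eqP/eqP => [E|->]; last by field.
  have -> : s = (y + z * s) / z - y / z by field.
  by rewrite E; field.
- exact: negbTE.
Qed.

End PlaneCoordinates.

(** * Rich vertices *)

Section Neighbourhoods.
Local Open Scope ring_scope.
Variables (F : finFieldType) (R : archiRealFieldType).
Local Notation q := #|F|.
Local Notation I := (option F).

Definition edge_map (X : finType) (H : {set {set X}}) : pred {ffun I -> X} :=
  [pred w : {ffun I -> X} | [set w i | i : I] \in H].

Definition extends (X : finType) (H : {set {set X}}) (z : X) : pred {ffun F -> X} :=
  [pred u : {ffun F -> X} | z |: [set u s | s : F] \in H].

Definition deg (X : finType) (H : {set {set X}}) (V : {set X}) (z : X) : nat :=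
  #|[pred u in ffun_on (mem V) | extends H z u]|.

Definition rich (X : finType) (H : {set {set X}}) (tau : R) (V : {set X}) : {set X} :=
  [set z | tau * #|V|%:R ^+ q <= (deg H V z)%:R].

(** Sending [None] to [z] and the other points by [v] gives a homomorphism: [extends] handles the
    lines through [None], [linked] all the others. Different pairs give different maps. *)
Lemma sum_linked_le_hom_count (X : finType) (H : {set {set X}}) (V : I -> {set X}) :
  (\sum_z #|linked (edge_map H) (@slope F)
      (fun i => [pred u in ffun_on (mem (V i)) | extends H z u]) (enum {: F * F})|
    <= hom_count (PGedges F) H)%N.
Proof.
pose T z := linked (edge_map H) (@slope F)
      (fun i => [pred u in ffun_on (mem (V i)) | extends H z u]) (enum {: F * F}).
pose D := [set p : X * {ffun I -> {ffun F -> X}} | T p.1 p.2].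
pose f (p : X * {ffun I -> {ffun F -> X}}) : {ffun PGpt F -> X} :=
  [ffun x => if model_of x is Some m then p.2 m.1 m.2 else p.1].
have fE p m : f p (point_of m) = if m is Some m' then p.2 m'.1 m'.2 else p.1.
  by rewrite ffunE point_ofK.
have f_inj : injective f.
  move=> p p' e; have fe m : f p (point_of m) = f p' (point_of m) by rewrite e.
  case: p p' {e} fe => [z v] [z' v'] fe; congr pair.
    by have := fe None; rewrite !fE.
  apply/ffunP => i; apply/ffunP => s.
  by have := fe (Some (i, s)); rewrite !fE.
have -> : (\sum_z #|T z|)%N = #|D|.
  under eq_bigr do rewrite -sum1_card.
  rewrite pair_big_dep /= sum1dep_card; apply: eq_card => -[z v].
  by rewrite !inE.
rewrite -(card_imset _ f_inj); apply: subset_leq_card.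
apply/subsetP => g /imsetP[[z v]]; rewrite inE => /andP[/familyP Pv /allP Lv] ->.
rewrite inE; apply/forallP => e; apply/implyP => /PGedge_model[[i ->]|[l ->]];
  rewrite -imset_comp.
- have /andP[_] := Pv i; rewrite /extends /= => zH.
  suff -> : (f (z, v) \o @point_of F) @: (None |: [set Some (i, s) | s : F]) =
    z |: [set v i s | s : F] by [].
  rewrite imsetU1 /= fE /= -imset_comp; congr (_ |: _).
  by apply: eq_imset => s; rewrite /= fE.
- have := Lv l; rewrite mem_enum => /(_ isT) /= lH.
  suff -> : (f (z, v) \o @point_of F) @: [set Some (i, slope l i) | i : I] =
    [set along (@slope F) v l i | i : I] by [].
  by rewrite -imset_comp; apply: eq_imset => i; rewrite /= fE ffunE.
Qed.

(** The volume drops at most by the factor [c ^+ q.+1], so the old error is this much larger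
    relative to [W']. *)
Lemma good_shrink (X : finType) (h : pred {ffun I -> X}) (d eta c : R)
    (W W' : I -> {set X}) : 0 <= eta -> 0 < c ->
  good h d eta W -> (forall i, W' i \subset W i) ->
  (forall i, c * #|W i|%:R <= #|W' i|%:R) -> good h d (eta / c ^+ q.+1) W'.
Proof.
move=> eta0 c0 gW sW'W szW' A sAW'.
have := gW A (fun i => subset_trans (sAW' i) (sW'W i)).
apply: le_trans; rewrite lerD2l lerN2 mulrAC ler_pdivlMr ?exprn_gt0 // -mulrA.
apply: ler_wpM2l => //.
have -> : vol R W * c ^+ q.+1 = \prod_i (c * #|W i|%:R).
  by rewrite big_split /= prodr_const card_option mulrC.
by apply: ler_prod => i _; rewrite szW' andbT mulr_ge0 // ltW.
Qed.

(** A vertex rich for all sides of a good box lies in a positive proportion of the possible planes,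
    so [H] has too many planes if there are many such vertices. Goodness survives shrinking by [c],
    and [nu] is fixed before [lambda], so that shrinking factors can be chosen before the sizes of
    sets. *)
Lemma card_rich_cap (d c tau gamma : R) :
  0 < d <= 1 -> 0 < c <= 1 -> 0 < tau <= 1 -> 0 < gamma ->
  exists2 nu : R, 0 < nu <= 1 & forall lambda : R, 0 < lambda ->
  exists2 t : R, 0 < t & forall (X : finType) (H : {set {set X}}), (0 < #|X|)%N ->
  (hom_count (PGedges F) H)%:R <= t * #|X|%:R ^+ (q.+1 * q).+1 ->
  forall U : I -> {set X}, (forall i, lambda * #|X|%:R <= #|U i|%:R) ->
  d * vol R U <= ecount R (edge_map H) U ->
  exists W : I -> {set X}, [/\ forall i, W i \subset U i,
    forall i, nu * #|U i|%:R <= #|W i|%:R &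
    forall W' : I -> {set X}, (forall i, W' i \subset W i) ->
      (forall i, c * #|W i|%:R <= #|W' i|%:R) ->
      #|\bigcap_i rich H tau (W' i)|%:R <= gamma * #|X|%:R].
Proof.
move=> /andP[d0 d1] /andP[c0 c1] /andP[tau0 tau1] gamma0.
have q0 : (0 < q)%N by apply/card_gt0P; exists 0.
have Q1 : 1 <= (q * q)%:R :> R by rewrite ler1n muln_gt0 q0.
(* A factor [tau] for each line through [z] and a factor [d] for each other line. *)
pose B := d ^+ (q * q) * tau ^+ q.+1.
have B0 : 0 < B by rewrite mulr_gt0 // exprn_gt0.
have B1 : B <= 1 by rewrite mulr_ile1 ?exprn_ile1 ?exprn_ge0 // ltW.
(* After shrinking by [c], the errors of the [q * q] lines add up to [B / 2], half of the main
   term. *)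
pose eta := c ^+ q.+1 * (B / (2 * (q * q)%:R)).
have eta0 : 0 < eta by rewrite mulr_gt0 ?exprn_gt0 // divr_gt0 // mulr_gt0 //; lra.
have eta1 : eta <= 1.
  rewrite mulr_ile1 ?exprn_ge0 ?exprn_ile1 ?(ltW c0) //.
    by rewrite divr_ge0 ?(ltW B0) // mulr_ge0.
  by rewrite ler_pdivrMr; lra.
have [|nu nu01 boxP] := @good_subbox R I d eta (ltW d0); first by rewrite eta0.
exists nu => // lambda lambda0; have nu0 : 0 < nu by case/andP: nu01.
(* Every [W' i] has at least [m * #|X|] elements, which gives the bound on planes below. *)
pose m := c * (nu * lambda).
have m0 : 0 < m by rewrite !mulr_gt0.
exists (gamma * (B / 2 * m ^+ (q.+1 * q))).
  by rewrite mulr_gt0 // mulr_gt0 ?exprn_gt0 // divr_gt0.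
move=> X H X0 homH U szU /boxP[W [sWU szW gW]]; exists W; split=> // W' sW'W szW'.
have n0 : 0 < #|X|%:R :> R by rewrite ltr0n.
have gW' := good_shrink (ltW eta0) c0 gW sW'W szW'.
have szn i : m * #|X|%:R <= #|W' i|%:R.
  apply: le_trans (szW' i); rewrite /m -mulrA ler_wpM2l ?(ltW c0) //.
  apply: le_trans (szW i); rewrite -mulrA ler_wpM2l ?(ltW nu0) //.
have volW'm : (m * #|X|%:R) ^+ q.+1 <= vol R W'.
  rewrite -card_option -prodr_const; apply: ler_prod => i _.
  by rewrite szn mulr_ge0 // ltW.
have volW' : 0 < vol R W' by apply: lt_le_trans volW'm; rewrite exprn_gt0 // mulr_gt0.
pose P z i := [pred u in ffun_on (mem (W' i)) | extends H z u] : pred {ffun F -> X}.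
have PW' z i u : P z i u -> forall s, u s \in W' i by case/andP => /ffun_onP.
rewrite leNgt; apply/negP => big; have := homH; apply/negP; rewrite -ltNge.
have many z : z \in \bigcap_i rich H tau (W' i) ->
    B / 2 * vol R W' ^+ q <= #|linked (edge_map H) (@slope F) (P z) (enum {: F * F})|%:R.
  move=> /bigcapP zr.
  have := linked_count None (@slope_linear F) (ltW d0) d1 _ gW' volW' (PW' z) (enum_uniq {: F * F}).
  rewrite -cardE card_prod => /(_ (divr_ge0 (ltW eta0) (exprn_ge0 _ (ltW c0)))).
  apply: le_trans.
  have -> : (q * q)%:R * (eta / c ^+ q.+1) = B / 2.
    rewrite /eta; field.
    by rewrite expf_neq0 ?gt_eqF // ltr0n.
  have : tau ^+ q.+1 * vol R W' ^+ q <= \prod_i #|P z i|%:R.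
    rewrite -card_option -prodr_const -prodrXl -big_split /=; apply: ler_prod => i _.
    have := zr i isT; rewrite inE => ->; rewrite andbT mulr_ge0 ?exprn_ge0 //; exact: ltW.
  move/(ler_wpM2l (exprn_ge0 (q * q) (ltW d0))); rewrite mulrA -/B; lra.
apply: (@lt_le_trans _ _ (#|\bigcap_i rich H tau (W' i)|%:R * (B / 2 * vol R W' ^+ q))).
  have -> : gamma * (B / 2 * m ^+ (q.+1 * q)) * #|X|%:R ^+ (q.+1 * q).+1 =
      gamma * #|X|%:R * (B / 2 * (m * #|X|%:R) ^+ (q.+1 * q)).
    by set e := (q.+1 * q)%N; rewrite exprS (exprMn e m); ring.
  apply: (@le_lt_trans _ _ (gamma * #|X|%:R * (B / 2 * vol R W' ^+ q))).
    rewrite ler_wpM2l ?mulr_ge0 ?(ltW gamma0) // ler_wpM2l ?divr_ge0 ?(ltW B0) //.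
    by rewrite exprM lerXn2r // nnegrE ?vol_ge0 // exprn_ge0 // mulr_ge0 // ltW.
  by rewrite ltr_pM2r // mulr_gt0 ?exprn_gt0 // divr_gt0.
apply: le_trans (_ : (\sum_z #|linked (edge_map H) (@slope F) (P z) (enum {: F * F})|)%:R <= _).
  rewrite natr_sum mulr_natl -sumr_const [leRHS](bigID (mem (\bigcap_i rich H tau (W' i)))) /=.
  apply: ler_wpDr; first exact: sumr_ge0.
  exact: ler_sum.
by rewrite ler_nat; apply: sum_linked_le_hom_count.
Qed.
End Neighbourhoods.

(** * Stable sets *)

Lemma card_bigcup_le (J X : finType) (P : pred J) (B : J -> {set X}) :
  #|\bigcup_(j | P j) B j| <= \sum_(j | P j) #|B j|.
Proof.
elim/big_ind2: _ => [|A m A' m' hA hA'|//]; first by rewrite cards0.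
by rewrite cardsU (leq_trans (leq_subr _ _)) // leq_add.
Qed.

Section Stability.
Local Open Scope ring_scope.
Variables (F : finFieldType) (R : archiRealFieldType).
Local Notation q := #|F|.
Local Notation k := #|F|.+1.
Local Notation I := (option F).

(** Few planes, together with an averaged form of the codegree condition, which says something only
    about [V] of linear size. *)
Definition admissible (t : R) (X : finType) (H : {set {set X}}) :=
  [/\ (0 < #|X|)%N,
    (hom_count (PGedges F) H)%:R <= t * #|X|%:R ^+ (k * q).+1 &
    forall V : {set X},
      #|V|%:R ^+ q * #|X|%:R / 2 - t * #|X|%:R ^+ k
      <= (\sum_z deg F H V z)%:R].

(* [P X H] holds as soon as the parameter [t] of [H] is small enough; this carries the
   hierarchy of constants, so that only the order in which they are chosen matters. *)
Definition eventually (P : forall X : finType, {set {set X}} -> Prop) :=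
  exists2 t : R, 0 < t & forall (X : finType) (H : {set {set X}}), admissible t H -> P X H.

Lemma admissible_le t t' (X : finType) (H : {set {set X}}) : t <= t' ->
  admissible t H -> admissible t' H.
Proof.
move=> tt' [X0 hom dg]; split=> // [|V].
  by apply: le_trans hom _; rewrite ler_wpM2r // exprn_ge0.
by apply: le_trans (dg V); rewrite lerD2l lerN2 ler_wpM2r // exprn_ge0.
Qed.

Lemma eventually_and P Q : eventually P -> eventually Q ->
  eventually (fun X H => P X H /\ Q X H).
Proof.
move=> [t t0 tP] [t' t'0 tQ]; exists (Num.min t t'); first by rewrite lt_min t0.
move=> X H nH; split; [apply: tP | apply: tQ]; apply: admissible_le nH.
  by rewrite ge_min lexx.
by rewrite ge_min lexx orbT.
Qed.

Lemma eventually_imp P Q : (forall X (H : {set {set X}}), (0 < #|X|)%N -> P X H -> Q X H) ->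
  eventually P -> eventually Q.
Proof. by move=> PQ [t t0 tP]; exists t => // X H nH; apply: PQ (tP _ _ nH); case: nH. Qed.

(** Averaging: a rich vertex contributes at most [#|V| ^ q] to the degree sum, any other at most
    [tau] times this. *)
Lemma card_rich_ge (lambda tau gamma : R) : 0 < lambda -> 0 <= tau <= gamma -> 0 < gamma ->
  eventually (fun X H => forall V : {set X}, lambda * #|X|%:R <= #|V|%:R ->
    (1 / 2 - 2 * gamma) * #|X|%:R <= #|rich F H tau V|%:R).
Proof.
move=> l0 /andP[tau0 tg] g0; exists (gamma * lambda ^+ q).
  by rewrite mulr_gt0 // exprn_gt0.
move=> X H [X0 _ dg] V szV; set n : R := #|X|%:R in szV *.
have n0 : 0 < n by rewrite ltr0n.
have v0 : 0 < #|V|%:R :> R by apply: lt_le_trans szV; rewrite mulr_gt0.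
set v : R := #|V|%:R ^+ q; have vq0 : 0 < v by rewrite exprn_gt0.
have lev : lambda ^+ q * n ^+ q <= v.
  by rewrite -exprMn lerXn2r // nnegrE ?ler0n // mulr_ge0 // ltW.
have degle z : (deg F H V z)%:R <= v.
  rewrite /v -natrX ler_nat -card_ffun_on; apply: subset_leq_card.
  by apply/subsetP => u /andP[].
have upper : (\sum_z deg F H V z)%:R <= #|rich F H tau V|%:R * v + n * (tau * v).
  rewrite natr_sum (bigID (mem (rich F H tau V))) /=; apply: lerD.
    rewrite mulr_natl -sumr_const; apply: ler_sum => z _; exact: degle.
  apply: (@le_trans _ _ (\sum_(z | z \notin rich F H tau V) (tau * v))).
    by apply: ler_sum => z; rewrite inE -ltNge => /ltW.
  rewrite sumr_const -[leLHS]mulr_natl ler_wpM2r ?mulr_ge0 ?(ltW vq0) //.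
  by rewrite ler_nat max_card.
have := le_trans (dg V) upper; rewrite -/n -/v exprS.
have b1 : gamma * n * (lambda ^+ q * n ^+ q) <= gamma * n * v.
  by rewrite ler_wpM2l // mulr_ge0 // ltW.
have b2 : tau * n * v <= gamma * n * v by rewrite !ler_wpM2r // ltW.
move=> main; rewrite -(ler_pM2r vq0).
by move: (lambda ^+ q) (n ^+ q) (#|rich _ _ _ _|%:R) b1 main => *; lra.
Qed.

Lemma rich_sub (X : finType) (H : {set {set X}}) (c tau : R) (V V' : {set X}) :
  0 <= c -> 0 <= tau -> V' \subset V -> c * #|V|%:R <= #|V'|%:R ->
  rich F H tau V' \subset rich F H (tau * c ^+ q) V.
Proof.
move=> c0 tau0 sV szV; apply/subsetP => z; rewrite !inE => zr.
apply: (@le_trans _ _ (tau * #|V'|%:R ^+ q)).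
  rewrite -mulrA -exprMn ler_wpM2l // lerXn2r // nnegrE ?mulr_ge0 //.
apply: (le_trans zr); rewrite ler_nat; apply: subset_leq_card.
apply/subsetP => u /andP[/ffun_onP uV' uH]; rewrite inE uH andbT.
by apply/ffun_onP => s; apply: (subsetP sV); apply: uV'.
Qed.

Definition stable (X : finType) (H : {set {set X}}) (tau c gamma : R) (V : {set X}) :=
  forall V' : {set X}, V' \subset V -> c * #|V|%:R <= #|V'|%:R ->
  #|rich F H tau V :\: rich F H tau V'|%:R <= gamma * #|X|%:R.

(** It makes a stable set available for proving [C]. Its threshold [tau] is not under control, so
    [c] may depend on [tau], and only then is the size bound [lambda] given. *)
Lemma stability (gamma : R) (C : forall X : finType, {set {set X}} -> Prop) :
  0 < gamma ->
  (forall tau, 0 < tau <= gamma -> exists2 c : R, 0 < c <= 1 &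
    forall lambda : R, 0 < lambda -> eventually (fun X H => forall V : {set X},
      lambda * #|X|%:R <= #|V|%:R -> stable H tau c gamma V -> C X H)) ->
  eventually C.
Proof.
move=> g0 stC.
(* Otherwise pass to a subset of [V] losing [gamma * n] rich vertices; the threshold goes up
   at each step, so the descent must start from a threshold chosen last. *)
have descent (j : nat) : exists2 tau : R, 0 < tau <= gamma &
    forall lambda : R, 0 < lambda -> eventually (fun X H => forall V : {set X},
      lambda * #|X|%:R <= #|V|%:R ->
      #|rich F H tau V|%:R < j%:R * gamma * #|X|%:R -> C X H).
  elim: j => [|j [tau tau0g IHj]].
    exists gamma; first by rewrite g0 lexx.
    move=> lambda _; exists 1 => // X H _ V _.
    by rewrite !mul0r ltNge ler0n.
  have /andP[tau0 taug] := tau0g; have [c /andP[c0 c1] Cc] := stC tau tau0g.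
  exists (tau * c ^+ q).
    rewrite mulr_gt0 ?exprn_gt0 //=; apply: le_trans taug.
    by rewrite ler_piMr ?exprn_ile1 ?(ltW c0) ?(ltW tau0).
  move=> lambda l0; have lc0 : 0 < lambda * c by rewrite mulr_gt0.
  apply: eventually_imp (eventually_and (Cc _ l0) (IHj _ lc0)) => X H X0 [CX IHX] V szV small.
  have n0 : 0 < #|X|%:R :> R by rewrite ltr0n.
  have [st|] := pselect (stable H tau c gamma V); first exact: CX szV st.
  move=> /existsNP[V' /not_implyP[sV' /not_implyP[szV' /negP]]]; rewrite -ltNge => drop.
  apply: (IHX V'); first by apply: le_trans szV'; rewrite mulrAC mulrC ler_wpM2l ?(ltW c0).
  have sr := rich_sub H (ltW c0) (ltW tau0) sV' szV'.
  have sr2 : rich F H tau V \subset rich F H (tau * c ^+ q) V.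
    by apply: rich_sub; rewrite ?(ltW c0) ?(ltW tau0) // ler_piMl.
  (* Both disjoint sets lie in the rich set of [V] at the lower threshold; removing the first, of
     size over [gamma * n], brings [V'] under the bound for [j]. *)
  have : (#|rich F H tau V :\: rich F H tau V'| + #|rich F H tau V'|
      <= #|rich F H (tau * c ^+ q) V|)%N.
    rewrite -(cardsID (rich F H tau V') (rich F H (tau * c ^+ q) V)) (setIidPr sr) addnC.
    by rewrite leq_add2l subset_leq_card // setSD.
  rewrite -(ler_nat R) natrD; move: small; rewrite -natr1; lra.
(* With more than [1 / gamma] steps the bound exceeds [n] and holds for [V] the whole vertex set. *)
have [tau _ dC] := descent (Num.bound gamma^-1).+1.
apply: eventually_imp (dC 1 ltr01) => X H X0 /(_ [set: X]); apply; rewrite ?mul1r ?cardsT //.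
have n0 : 0 < #|X|%:R :> R by rewrite ltr0n.
apply: (@le_lt_trans _ _ #|X|%:R); first by rewrite ler_nat max_card.
rewrite ltr_pMl // -ltr_pdivrMr // -natr1.
rewrite div1r; have : gamma^-1 < (Num.bound gamma^-1)%:R by rewrite archi_boundP // invr_ge0 ltW.
lra.
Qed.

Lemma card_cap_bound (X : finType) (Y : {set X}) (Z : I -> {set X}) (gamma kappa : R) :
  #|\bigcap_i Z i|%:R <= gamma * #|X|%:R ->
  (forall i, #|Y :\: Z i|%:R <= kappa * #|X|%:R) ->
  #|Y|%:R <= (gamma + k%:R * kappa) * #|X|%:R.
Proof.
move=> capZ YZ.
have : (#|Y| <= #|\bigcap_i Z i| + \sum_i #|Y :\: Z i|)%N.
  apply: (@leq_trans #|\bigcap_i Z i :|: \bigcup_i (Y :\: Z i)|).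
    apply: subset_leq_card; apply/subsetP => y yY; rewrite inE.
    have [/forallP yZ|/forallPn[i yZ]] := boolP [forall i, y \in Z i].
      by apply/orP; left; apply/bigcapP => i _.
    by apply/orP; right; apply/bigcupP; exists i; rewrite // inE yZ.
  rewrite cardsU (leq_trans (leq_subr _ _)) // leq_add2l.
  exact: card_bigcup_le.
rewrite -(ler_nat R) natrD natr_sum mulrDl => /le_trans; apply; apply: lerD => //.
apply: le_trans (ler_sum _ (fun i _ => YZ i)) _.
by rewrite sumr_const card_option -mulrA mulr_natl.
Qed.

(** Since the sides of a good sub-box are not under control, every large [W] inside [V] must be
    shrinkable to a set for which almost all of [Y] is rich. *)
Definition hereditary (X : finType) (H : {set {set X}}) (tau c0 c kappa : R) (Y V : {set X}) :=
  forall W : {set X}, W \subset V -> c0 * #|V|%:R <= #|W|%:R ->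
  exists W' : {set X}, [/\ W' \subset W, c * #|W|%:R <= #|W'|%:R &
    #|Y :\: rich F H tau W'|%:R <= kappa * #|X|%:R].

(** Used in contrapositive form: shrinking the sides of a good box inside [U] makes almost all of
    [Y] rich for every side, so a large [Y] forces [U] to be sparse. *)
Lemma eventually_dense_box (d c tau gamma : R) :
  0 < d <= 1 -> 0 < c <= 1 -> 0 < tau <= 1 -> 0 < gamma ->
  exists2 nu : R, 0 < nu <= 1 & forall lambda : R, 0 < lambda ->
  eventually (fun X H => forall (kappa : R) (Y U : {set X}),
    lambda * #|X|%:R <= #|U|%:R -> hereditary H tau nu c kappa Y U ->
    d * vol R (fun _ : I => U) <= ecount R (edge_map H) (fun _ : I => U) ->
    #|Y|%:R <= (gamma + k%:R * kappa) * #|X|%:R).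
Proof.
move=> d01 c01 tau01 g0.
have [nu nu01 K] := card_rich_cap F d01 c01 tau01 g0; exists nu => // lambda l0.
have [t t0 Kt] := K _ l0; exists t => // X H [X0 hom _] kappa Y U szU her dU.
have [W [sWU szW capW]] := Kt X H X0 hom (fun=> U) (fun=> szU) dU.
have [W' hW'] := choice (fun i => her (W i) (sWU i) (szW i)).
apply: (@card_cap_bound _ _ (fun i => rich F H tau (W' i))); last by move=> i; case: (hW' i).
by apply: capW => i; case: (hW' i).
Qed.

End Stability.

(** * The partition *)

Section Partition.
Local Open Scope ring_scope.
Variables (F : finFieldType) (R : archiRealFieldType).
Local Notation q := #|F|.
Local Notation k := #|F|.+1.
Local Notation I := (option F).

Definition cone (X : finType) (U V : {set X}) (i : I) := if i is Some _ then V else U.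

Lemma vol_cone (X : finType) (U V : {set X}) : vol R (cone U V) = #|U|%:R * #|V|%:R ^+ q.
Proof.
rewrite /vol (bigD1 None) //=; congr (_ * _).
rewrite (eq_bigr (fun=> #|V|%:R)); last by case.
by rewrite prodr_const cardC1 card_option.
Qed.

Lemma ecount_cone (X : finType) (H : {set {set X}}) (tau : R) (U V : {set X}) :
  U \subset rich F H tau V -> tau * vol R (cone U V) <= ecount R (edge_map H) (cone U V).
Proof.
move=> sU; pose D := [set p : X * {ffun F -> X} |
  (p.1 \in U) && ((p.2 \in ffun_on (mem V)) && extends H p.1 p.2)].
pose f (p : X * {ffun F -> X}) : {ffun I -> X} := [ffun i => if i is Some a then p.2 a else p.1].
have f_inj : injective f.
  move=> [z u] [z' u'] /ffunP e; congr pair; first by have := e None; rewrite !ffunE.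
  by apply/ffunP => a; have := e (Some a); rewrite !ffunE.
have cardD : #|D| = (\sum_(z in U) deg F H V z)%N.
  under eq_bigr do rewrite /deg -sum1_card.
  rewrite pair_big_dep /= sum1dep_card; apply: eq_card => -[z u].
  by rewrite !inE.
apply: (@le_trans _ _ #|D|%:R).
  rewrite cardD vol_cone mulrCA mulr_natl -sumr_const natr_sum.
  by apply: ler_sum => z /(subsetP sU); rewrite inE.
rewrite ler_nat -(card_imset _ f_inj); apply: subset_leq_card.
apply/subsetP => w /imsetP[[z u]]; rewrite inE => /= /and3P[zU /ffun_onP uV zu] ->.
apply/andP; split; first by apply/familyP => -[a|]; rewrite ffunE //=; apply: uV.
change ([set f (z, u) i | i : I] \in H).
suff -> : [set f (z, u) i | i : I] = z |: [set u s | s : F] by [].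
apply/setP => x; rewrite !inE; apply/imsetP/orP => [[[a|] _ ->]|[/eqP ->|/imsetP[a _ ->]]].
- by right; rewrite ffunE; apply/imsetP; exists a.
- by left; rewrite ffunE.
- by exists None; rewrite ?ffunE.
- by exists (Some a); rewrite ?ffunE.
Qed.

(** The box with sides [U, V, ..., V] is dense because [U] is rich for [V]. In a good sub-box the
    side [W] in [U] is kept and the others are shrunk until almost all of [Y] is rich for them; so
    few vertices of [Y] are rich for [W] too. *)
Lemma eventually_cone (c tau gamma : R) :
  0 < c <= 1 -> 0 < tau <= 1 -> 0 < gamma ->
  exists2 nu : R, 0 < nu <= 1 & forall lambda : R, 0 < lambda ->
  eventually F R (fun X H => forall (kappa : R) (Y U V : {set X}), 0 <= kappa ->
    lambda * #|X|%:R <= #|U|%:R -> lambda * #|X|%:R <= #|V|%:R ->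
    hereditary F H tau nu c kappa Y V -> U \subset rich F H tau V ->
    exists W : {set X}, [/\ W \subset U, nu * #|U|%:R <= #|W|%:R &
      #|Y :&: rich F H tau W|%:R <= (gamma + k%:R * kappa) * #|X|%:R]).
Proof.
move=> c01 tau01 g0; have /andP[c0 c1] := c01.
have [nu nu01 K] := card_rich_cap F tau01 c01 tau01 g0; exists nu => // lambda l0.
have [t t0 Kt] := K _ l0; exists t => // X H [X0 hom _] kappa Y U V kap0 szU szV her sU.
have szUV i : lambda * #|X|%:R <= #|cone U V i|%:R by case: i.
have [W [sW szW capW]] := Kt X H X0 hom (cone U V) szUV (ecount_cone sU).
have shrink i : exists W' : {set X}, [/\ W' \subset W i, c * #|W i|%:R <= #|W'|%:R &
    #|(Y :&: rich F H tau (W None)) :\: rich F H tau W'|%:R <= kappa * #|X|%:R /\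
    (i = None -> W' = W i)].
  case: i => [a|].
    have [W' [sW' szW' YW']] := her _ (sW (Some a)) (szW (Some a)).
    exists W'; split=> //; split=> //; apply: le_trans YW'.
    by rewrite ler_nat subset_leq_card // setSD // subsetIl.
  exists (W None); split=> //; first by rewrite ler_piMl.
  split=> //; rewrite (_ : _ :\: _ = set0) ?cards0 ?mulr_ge0 //.
  by apply/eqP; rewrite setD_eq0 subsetIr.
have [W' hW'] := choice shrink.
exists (W None); split; [exact: (sW None) | exact: (szW None) |].
apply: (@card_cap_bound _ _ _ _ (fun i => rich F H tau (W' i))).
  by apply: capW => i; case: (hW' i).
by move=> i; case: (hW' i) => _ _ [].
Qed.

(** Union bound over the coordinate that falls in [T :\: T']. *)
Lemma ecount_restrict (X : finType) (h : pred {ffun I -> X}) (T T' : {set X}) :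
  ecount R h (fun=> T) <= ecount R h (fun=> T') + k%:R * #|T :\: T'|%:R * #|X|%:R ^+ q.
Proof.
pose D i := [pred w : {ffun I -> X} | w i \in T :\: T'].
have cardD i : #|D i|%:R = #|T :\: T'|%:R * #|X|%:R ^+ q :> R.
  have -> : #|D i| = #|family (fun j => if j == i then T :\: T' else setT)|.
    apply: eq_card => w; rewrite [LHS]unfold_in /=; apply/idP/familyP => [wi j|/(_ i)].
      by have [->|_] := eqVneq j i; rewrite ?inE // -in_setD.
    by rewrite eqxx.
  rewrite card_box /vol (bigD1 i) //= eqxx; congr (_ * _).
  rewrite (eq_bigr (fun=> #|X|%:R)); last by move=> j /negbTE ->; rewrite cardsT.
  by rewrite prodr_const cardC1 card_option.
have -> : k%:R * #|T :\: T'|%:R * #|X|%:R ^+ q = (\sum_i #|D i|)%:R :> R.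
  rewrite natr_sum (eq_bigr _ (fun i _ => cardD i)) sumr_const card_option.
  by rewrite -mulrA mulr_natl.
rewrite /ecount -natrD ler_nat.
pose A (S : {set X}) := [set w : {ffun I -> X} | (w \in family (fun=> S)) && h w].
have cA (S : {set X}) : #|[pred w in family (fun=> S) | h w]| = #|A S|.
  by apply: eq_card => w; rewrite !inE.
rewrite !cA; apply: (@leq_trans #|A T' :|: \bigcup_i [set w in D i]|).
  apply: subset_leq_card; apply/subsetP => w; rewrite inE => /andP[/familyP wT hw]; rewrite in_setU.
  have [/forallP wT'|/forallPn[i wT']] := boolP [forall i, w i \in T'].
    by rewrite [w \in A T']inE hw andbT; apply/orP; left; apply/familyP.
  apply/orP; right; apply/bigcupP; exists i; rewrite // !inE wT' /=; exact: wT.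
rewrite cardsU (leq_trans (leq_subr _ _)) // leq_add2l.
by apply: leq_trans (card_bigcup_le _ _) _; apply: leq_sum => i _; rewrite cardsE.
Qed.

Lemma eventually_partition (eps : R) : 0 < eps <= 1 ->
  eventually F R (fun X H => exists A : {set X},
    ecount R (edge_map H) (fun _ : I => A) + ecount R (edge_map H) (fun _ : I => ~: A)
      <= eps * #|X|%:R ^+ k).
Proof.
move=> /andP[eps0 eps1].
pose K : R := k%:R.
have K1 : 1 <= K by rewrite ler1n.
(* [kap1 * gamma] and [kap2 * gamma] bound the errors with which small sets inside the
   two parts determine the opposite part. *)
pose kap1 := K + 5; pose kap2 := 6 + 2 * K + K * kap1.
have kap10 : 0 < kap1 by rewrite /kap1; lra.
have kap20 : 0 < kap2 by rewrite /kap2; nra.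
pose gamma := eps / (8 * (1 + K) * (1 + kap1 + kap2)).
have D0 : 1 <= (1 + K) * (1 + kap1 + kap2) by nra.
have g0 : 0 < gamma by rewrite divr_gt0 //; lra.
have gE : gamma * ((1 + K) * (1 + kap1 + kap2)) = eps / 8.
  by rewrite /gamma; field; rewrite !gt_eqF //; lra.
have g1 : gamma <= 1 / 8 by nra.
clearbody gamma.
pose e1 := eps / 4.
have e101 : 0 < e1 <= 1 by rewrite /e1; lra.
apply: (stability g0) => tau taug; have /andP[tau0 tau_le] := taug.
have tau01 : 0 < tau <= 1 by lra.
(* The shrinking factors are those by which hereditariness will hold: 1 for [V], by stability, [nu1]
   for subsets of [S], [nu2] for subsets of [T']. *)
have [nu1 nu101 St1] := @eventually_cone 1 tau gamma ltac:(lra) tau01 g0.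
have [nu2 nu201 St2] := eventually_cone nu101 tau01 g0.
have [nu3 nu301 Dn1] := eventually_dense_box F e101 nu101 tau01 g0.
have [nu4 nu401 Dn2] := eventually_dense_box F e101 nu201 tau01 g0.
exists nu1 => // lambda l0.
(* [S] and [T'] will have at least [n / 4] elements. [mu] bounds the sets fed to the lemmas, and
   [mu'] also the subsets returned. *)
pose l1 := Num.min lambda (1 / 4).
have l10 : 0 < l1 by rewrite lt_min l0 /=; lra.
have [/andP[n10 n11] /andP[n20 n21] /andP[n30 n31] /andP[n40 n41]] := And4 nu101 nu201 nu301 nu401.
pose mu := l1 * nu1 * nu2 * nu3 * nu4.
have mu0 : 0 < mu by rewrite !mulr_gt0.
have m1 x y : 0 <= x -> y <= 1 -> x * y <= x :> R by move=> *; rewrite ler_piMr.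
have mul1 : mu <= l1 * nu1 * nu2.
  by rewrite /mu; apply: le_trans (m1 _ _ _ n41) (m1 _ _ _ n31); rewrite ?mulr_ge0 // ltW.
have mu3 : mu <= l1 * nu3.
  rewrite /mu; apply: le_trans (m1 _ _ _ n41) _; first by rewrite !mulr_ge0 // ltW.
  rewrite ler_wpM2r ?(ltW n30) //.
  by apply: le_trans (m1 _ _ _ n21) (m1 _ _ _ n11); rewrite ?mulr_ge0 // ltW.
have mu4 : mu <= l1 * nu4.
  rewrite /mu ler_wpM2r ?(ltW n40) //; apply: le_trans (m1 _ _ _ n31) _.
    by rewrite !mulr_ge0 // ltW.
  by apply: le_trans (m1 _ _ _ n21) (m1 _ _ _ n11); rewrite ?mulr_ge0 // ltW.
have l1l : l1 <= lambda by rewrite ge_min lexx.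
have l14 : l1 <= 1 / 4 by rewrite ge_min lexx orbT.
have mul : mu <= l1.
  by apply: le_trans mu3 _; apply: m1; rewrite // ltW.
pose mu' := mu * (nu1 * nu2).
have mu'0 : 0 < mu' by rewrite !mulr_gt0.
have rl := @card_rich_ge F R mu' tau gamma mu'0 ltac:(by rewrite ltW) g0.
apply: eventually_imp (eventually_and rl (eventually_and (St1 mu mu0) (eventually_and (St2 mu mu0)
  (eventually_and (Dn1 mu mu0) (Dn2 mu mu0))))).
move=> X H X0 [{}rl [{}St1 [{}St2 [{}Dn1 {}Dn2]]]] V szV stV.
pose n : R := #|X|%:R; rewrite -/n in szV *.
have n0 : 0 < n by rewrite ltr0n.
have [g Eg] : exists g, gamma * n = g by exists (gamma * n).
have gg0 : 0 < g by rewrite -Eg mulr_gt0.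
have gn : (1 + K) * (1 + kap1 + kap2) * g <= n / 8.
  rewrite -Eg mulrCA mulrA gE.
  have : eps * n <= n by rewrite ler_piMl // ltW.
  lra.
have p1 : 0 <= K * g by rewrite mulr_ge0 //; lra.
have p2 : 0 <= K * (K * g) by rewrite mulr_ge0 //; lra.
have p3 : 0 <= K * (K * (K * g)) by rewrite mulr_ge0 //; lra.
move: (gn); rewrite /kap2 /kap1 => gnK.
have l1n : l1 * n <= n / 4 by rewrite [n / 4]mulrC -div1r ler_wpM2r // ltW.
have le_n (x y : R) : x <= y -> x * n <= y * n by move=> ?; rewrite ler_wpM2r // ltW.
pose Z := rich F H tau; pose S := Z V; pose T := ~: S.
have parts (A : {set X}) :
    [/\ #|S :&: A|%:R + #|S :\: A|%:R = #|S|%:R :> R,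
      #|T :&: A|%:R + #|T :\: A|%:R = #|T|%:R :> R,
      #|S :&: A|%:R + #|T :&: A|%:R = #|A|%:R :> R & #|S|%:R + #|T|%:R = n].
  rewrite -!natrD !cardsID /T setIC [~: S :&: A]setIC -setDE cardsID.
  by rewrite /n -(cardsC S).
have mu'1 x : mu * n <= x -> mu' * n <= nu1 * x.
  move=> mx; rewrite /mu' mulrAC mulrCA ler_wpM2l ?(ltW n10) //.
  by apply: le_trans mx; rewrite ler_piMr // mulr_ge0 // ltW.
have mu'2 x : mu * n <= x -> mu' * n <= nu2 * x.
  move=> mx; rewrite /mu' [nu1 * _]mulrC mulrAC mulrCA ler_wpM2l ?(ltW n20) //.
  by apply: le_trans mx; rewrite ler_piMr // mulr_ge0 // ltW.
have rlV : n / 2 - 2 * g <= #|S|%:R.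
  have : mu' * n <= #|V|%:R.
    apply: le_trans szV; apply: le_n; apply: le_trans l1l; apply: le_trans mul.
    by apply: m1; rewrite ?(ltW mu0) // mulr_ile1 // ltW.
  by move/rl; rewrite -/n mulrBl -!mulrA Eg; lra.
(* The rich set of [W'] has almost [n / 2] elements and hardly meets [S], while [#|T|] is at most
   about [n / 2]; so it fills [T], and [S] cannot be much larger than [n / 2]. *)
have H2 (W : {set X}) : W \subset S -> mu * n <= #|W|%:R ->
    exists W' : {set X}, [/\ W' \subset W, nu1 * #|W|%:R <= #|W'|%:R,
      #|T :\: Z W'|%:R <= kap1 * gamma * n & #|S|%:R <= n / 2 + (3 + K) * g].
  move=> sW szW.
  have herV : hereditary F H tau nu1 1 gamma S V.
    move=> W1 sW1 szW1; exists W1; split; rewrite ?mul1r //.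
    exact: stV.
  have szV' : mu * n <= #|V|%:R by apply: le_trans szV; apply: le_n; apply: le_trans l1l.
  have [W' [sW' szW' capW']] := St1 gamma S W V (ltW g0) szW szV' herV sW.
  exists W'; split=> //.
    have [e1' e2 e3 e4] := parts (Z W').
    have := rl W' (le_trans (mu'1 _ szW) szW').
    move: capW'; rewrite -/n !mulrBl !mulrDl -!mulrA Eg => a1 a2.
    rewrite /kap1; lra.
  have [e1' e2 e3 e4] := parts (Z W').
  have := rl W' (le_trans (mu'1 _ szW) szW').
  move: capW'; rewrite -/n !mulrBl !mulrDl -!mulrA Eg => a1 a2.
  have : 0 <= #|T :\: Z W'|%:R :> R by [].
  lra.
have mun : mu * n <= l1 * n by apply: le_n.
have szS4 : l1 * n <= #|S|%:R by lra.
have szS : mu * n <= #|S|%:R by apply: le_trans szS4.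
have [W' [sW'S szW' TW' leS]] := H2 S (subxx S) szS.
(* Almost all of [T], and rich for [W'], so subsets of [T'] can be apex sides of cones over [W'],
   which is hereditary by [H2]. *)
pose T' := T :&: Z W'.
have szW'4 : l1 * nu1 * n <= #|W'|%:R.
  by apply: le_trans szW'; rewrite mulrAC mulrC ler_wpM2l // ltW.
have H3 (U : {set X}) : U \subset T' -> mu * n <= #|U|%:R ->
    exists W : {set X}, [/\ W \subset U, nu2 * #|U|%:R <= #|W|%:R &
      #|S :\: Z W|%:R <= kap2 * gamma * n].
  move=> sU szU.
  have her : hereditary F H tau nu2 nu1 (kap1 * gamma) T W'.
    move=> W1 sW1 szW1; have [||W2 [? ? ? _]] := H2 W1.
    - exact: subset_trans sW1 sW'S.
    - apply: le_trans szW1; apply: le_trans (le_n _ _ mul1) _.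
      by rewrite mulrAC mulrC ler_wpM2l // ltW.
    by exists W2.
  have kg : 0 <= kap1 * gamma by rewrite mulr_ge0 // ltW.
  have szW'mu : mu * n <= #|W'|%:R.
    apply: le_trans szW'4; apply: le_n; apply: le_trans mul1 _.
    by rewrite m1 // mulr_ge0 // ltW.
  have [W [sW szW capW]] := St2 _ T U W' kg szU szW'mu her (subset_trans sU (subsetIr _ _)).
  exists W; split=> //.
  have [e1' e2 e3 e4] := parts (Z W).
  have := rl W (le_trans (mu'2 _ szU) szW); rewrite -/n mulrBl -!mulrA Eg => a2.
  move: capW; rewrite -/n -/K mulrDl -!mulrA Eg /kap2 /kap1; lra.
have szT' : l1 * n <= #|T'|%:R.
  have [e1' e2 e3 e4] := parts (Z W').
  by move: TW'; rewrite -mulrA Eg /kap1 /T'; lra.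
have vol_le (A : {set X}) : e1 * vol R (fun _ : I => A) <= e1 * n ^+ k.
  rewrite ler_wpM2l //; first by rewrite /e1; lra.
  rewrite /vol prodr_const card_option lerXn2r ?nnegrE // ler_nat; exact: max_card.
(* Otherwise [H2] and [Dn1] would bound [#|T|] by a small multiple of [g], although [#|T|] is about
   [n / 2]. *)
have fewS : ecount R (edge_map H) (fun _ : I => S) < e1 * n ^+ k.
  rewrite ltNge; apply/negP => /(le_trans (vol_le S)) dS.
  have : #|T|%:R <= (gamma + K * (kap1 * gamma)) * n.
    apply: (Dn1 _ T S szS) dS => W sW szW; have [|W2 [? ? ? _]] := H2 W sW.
      apply: le_trans szW; apply: le_trans (le_n _ _ mu3) _.
      by rewrite mulrAC mulrC ler_wpM2l // ltW.
    by exists W2.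
  have [_ _ _ e4] := parts S.
  by rewrite -/n mulrDl -!mulrA Eg /kap1; lra.
have fewT' : ecount R (edge_map H) (fun _ : I => T') < e1 * n ^+ k.
  rewrite ltNge; apply/negP => /(le_trans (vol_le T')) dT'.
  have szT'mu : mu * n <= #|T'|%:R by apply: le_trans szT'; apply: le_n.
  have : #|S|%:R <= (gamma + K * (kap2 * gamma)) * n.
    apply: (Dn2 _ S T' szT'mu) dT' => W sW szW; apply: H3 => //.
    apply: le_trans szW; apply: le_trans (le_n _ _ mu4) _.
    by rewrite mulrAC mulrC ler_wpM2l // ltW.
  by rewrite -/n mulrDl -!mulrA Eg /kap2 /kap1; lra.
exists S; have := ecount_restrict (edge_map H) T T'.
have -> : T :\: T' = T :\: Z W' by rewrite setDIr setDv set0U.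
have : K * #|T :\: Z W'|%:R * n ^+ q <= K * (kap1 * gamma) * n ^+ k.
  rewrite exprS -!mulrA ler_wpM2l //.
  by rewrite !mulrA ler_wpM2r ?exprn_ge0 // ltW.
have : K * (kap1 * gamma) <= eps / 8.
  have b0 : 0 <= kap1 * gamma by rewrite mulr_ge0 // ltW.
  have b1 : 0 <= kap2 * gamma by rewrite mulr_ge0 // ltW.
  have b2 : 0 <= K * gamma by rewrite mulr_ge0 //; lra.
  have b3 : 0 <= K * (kap2 * gamma) by rewrite mulr_ge0 //; lra.
  rewrite -gE; lra.
have N0 : 0 <= n ^+ k by rewrite exprn_ge0 // ltW.
move=> /(ler_wpM2r N0) b1 b2 b3.
have N1 : 0 <= eps * n ^+ k by rewrite mulr_ge0 // ltW.
move: fewS fewT' b1 b2 b3 N1; rewrite -/n -/K /e1; move: (n ^+ k) (n ^+ q) => N N'; lra.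
Qed.
End Partition.

(** * From the hypotheses to the counting conditions *)

Lemma ffact_le_expn n m : n ^_ m <= n ^ m.
Proof.
elim: m => // m IHm; rewrite ffactnSr expnSr; apply: leq_mul => //.
exact: leq_subr.
Qed.

(** Non-injective maps are a proportion of at most [m ^ 2 / n]; both sides carry an extra factor [n]
    to avoid division. *)
Lemma expn_le_ffact n m : n ^ m.+1 <= n * n ^_ m + m ^ 2 * n ^ m.
Proof.
elim: m => [|m IHm]; first by rewrite expn1 ffactn0 muln1 addn0.
have fm := ffact_le_expn n m; rewrite ffactnSr.
have [mn|/ltnW nm] := leqP m n.
  have e : n * n ^_ m * n = n * (n ^_ m * (n - m)) + m * (n * n ^_ m) by nia.
  have b1 : m * (n * n ^_ m) <= m * (n * n ^ m) by rewrite !leq_mul2l fm !orbT.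
  have b2 : n * n ^ m.+1 <= n * (n * n ^_ m + m ^ 2 * n ^ m) by rewrite leq_mul2l IHm orbT.
  rewrite (expnS n m.+1) (expnS n m) in b2 *; move: (n ^ m) (n ^_ m) e b1 b2 => x y e b1 b2.
  nia.
rewrite (expnS n m.+1) (_ : n - m = 0); last by apply/eqP; rewrite subn_eq0.
rewrite !muln0 add0n leq_mul2r; apply/orP; right; nia.
Qed.

Section Hypotheses.
Local Open Scope ring_scope.
Variables (F : finFieldType) (R : archiRealFieldType).
Local Notation q := #|F|.
Local Notation k := #|F|.+1.
Local Notation I := (option F).
Variables (X : finType) (H : {set {set X}}).
Hypothesis uniformH : forall e, e \in H -> #|e| = k.

(** By uniformity an edge has as many elements as [I], hence is the image of an injection of [I]. *)
Lemma inside_edges_le (A : {set X}) :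
  #|inside_edges H A|%:R <= ecount R (edge_map H) (fun _ : I => A)
    + ecount R (edge_map H) (fun _ : I => ~: A).
Proof.
pose B (S : {set X}) := [set w : {ffun I -> X} | (w \in family (fun=> S)) && edge_map H w].
have cB (S : {set X}) : #|[pred w in family (fun _ : I => S) | edge_map H w]| = #|B S|.
  by apply: eq_card => w; rewrite !inE.
rewrite /ecount !cB -natrD ler_nat.
pose im (w : {ffun I -> X}) := [set w i | i : I].
apply: (@leq_trans #|im @: (B A :|: B (~: A))|).
  apply: subset_leq_card; apply/subsetP => e; rewrite inE => /andP[eH eA].
  have ce : #|{: I}| = #|e| by rewrite uniformH // card_option.
  pose w : {ffun I -> X} := [ffun i => enum_val (cast_ord ce (enum_rank i))].
  have we i : w i \in e by rewrite ffunE enum_valP.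
  have imw : im w = e.
    apply/eqP; rewrite eqEcard; apply/andP; split.
      by apply/subsetP => x /imsetP[i _ ->].
    rewrite card_imset ?ce // => i j; rewrite !ffunE => /enum_val_inj /cast_ord_inj.
    exact: enum_rank_inj.
  apply/imsetP; exists w => //; rewrite inE.
  have mem (S : {set X}) : e \subset S -> w \in B S.
    move=> eS; rewrite inE; apply/andP; split; last by change (im w \in H); rewrite imw.
    by apply/familyP => i; apply: (subsetP eS).
  by case/orP: eA => /mem ->; rewrite ?orbT.
by rewrite (leq_trans (leq_imset_card _ _)) // cardsU leq_subr.
Qed.

Lemma nbhd_le (Q : {set X}) : #|Q| = q -> (#|nbhd H Q| <= #|[set z | z |: Q \in H]|)%N.
Proof.
move=> cQ; rewrite -(card_imset _ (@set1_inj X)); apply: subset_leq_card.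
apply/subsetP => T; rewrite inE => /andP[dTQ QTH].
have : #|T| == 1%N.
  have := uniformH QTH; rewrite cardsU cQ.
  have -> : Q :&: T = set0 by rewrite setIC; apply/eqP; rewrite setI_eq0.
  by rewrite cards0 subn0 -addn1 => /addnI ->.
case/cards1P => z Tz; apply/imsetP; exists z => //.
by rewrite inE setUC -Tz.
Qed.

(** Double counting of pairs of a vertex and a map into [V]. Injective maps with image outside [L]
    have about [n / 2] extensions; non-injective maps and those with image in [L] each number at
    most [theta * n ^ q]. *)
Lemma sum_deg_ge (L : {set {set X}}) (theta : R) (V : {set X}) :
  0 <= theta <= 1 / 2 -> (0 < #|X|)%N ->
  (forall Q : {set X}, #|Q| = q -> Q \notin L -> (1 / 2 - theta) * #|X|%:R <= #|nbhd H Q|%:R) ->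
  (forall Q, Q \in L -> #|Q| = q) ->
  (q`! * #|L|)%:R <= theta * #|X|%:R ^+ q ->
  (q ^ 2)%:R <= theta * #|X|%:R ->
  #|V|%:R ^+ q * #|X|%:R / 2 - 2 * theta * #|X|%:R ^+ k <= (\sum_z deg F H V z)%:R.
Proof.
move=> /andP[th0 th1] X0 nbL L_q cardL bigX.
set n : R := #|X|%:R; have n0 : 0 < n by rewrite ltr0n.
pose im (u : {ffun F -> X}) := [set u s | s : F].
pose Good := [set u : {ffun F -> X} | [&& u \in ffun_on (mem V), injectiveb u & im u \notin L]].
have swap : (\sum_z deg F H V z =
    \sum_(u : {ffun F -> X} | u \in ffun_on (mem V)) #|[set z | extends H z u]|)%N.
  transitivity (\sum_z \sum_(u : {ffun F -> X} | (u \in ffun_on (mem V)) && extends H z u) 1)%N.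
    by apply: eq_bigr => z _; rewrite /deg -sum1_card; apply: eq_bigl => u.
  rewrite (exchange_big_dep (fun u => u \in ffun_on (mem V))) /=; last by move=> z u _ /andP[].
  by apply: eq_bigr => u uV; rewrite -sum1_card; apply: eq_bigl => z; rewrite inE uV.
have lower : (1 / 2 - theta) * n * #|Good|%:R <= (\sum_z deg F H V z)%:R.
  rewrite swap natr_sum mulrC mulr_natl -sumr_const.
  apply: (@le_trans _ _ (\sum_(u in Good) #|[set z | extends H z u]|%:R)).
    apply: ler_sum => u; rewrite inE => /and3P[_ /injectiveP iu uL].
    have cu : #|im u| = q by rewrite card_imset.
    by apply: le_trans (nbL _ cu uL) _; rewrite ler_nat; apply: nbhd_le.
  rewrite [leRHS](bigID (mem Good)) /= ler_wpDr ?sumr_ge0 // le_eqVlt; apply/orP; left.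
  apply/eqP; apply: eq_bigl => u; apply/idP/andP => [uG|[] //]; split=> //.
  by move: uG; rewrite inE => /and3P[].
have cover : (#|V| ^ q <= #|Good| + (#|X| ^ q - #|X| ^_ q) + q`! * #|L|)%N.
  pose L' := \bigcup_(Q in L) [set u : {ffun F -> X} in ffun_on (mem Q) | injectiveb u].
  apply: (@leq_trans #|(Good :|: ~: [set u : {ffun F -> X} | injectiveb u]) :|: L'|).
    rewrite -card_ffun_on; apply: subset_leq_card; apply/subsetP => u uV.
    rewrite in_setU in_setU in_setC !in_set uV /=.
    case: (boolP (injectiveb u)) => //= iu; rewrite orbF.
    case: (boolP (im u \in L)) => //= uL; apply/bigcupP; exists (im u) => //.
    by rewrite in_set iu andbT; apply/ffun_onP => s; apply/imsetP; exists s.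
  rewrite cardsU (leq_trans (leq_subr _ _)) // leq_add //.
    rewrite cardsU (leq_trans (leq_subr _ _)) // leq_add2l.
    by rewrite cardsCs setCK card_inj_ffuns card_ffun.
  apply: leq_trans (card_bigcup_le _ _) _.
  rewrite mulnC -sum_nat_const; apply: leq_sum => Q /L_q cQ.
  by rewrite card_inj_ffuns_on cQ ffactnn.
have ff : (#|X| ^ q - #|X| ^_ q)%:R <= theta * n ^+ q.
  rewrite -(ler_pM2l n0); have : (#|X| * (#|X| ^ q - #|X| ^_ q) <= q ^ 2 * #|X| ^ q)%N.
    by rewrite mulnBr leq_subLR -expnS expn_le_ffact.
  rewrite -(ler_nat R) !natrM [(#|X| ^ q)%:R]natrX => /le_trans; apply.
  rewrite mulrA [n * theta]mulrC; apply: ler_wpM2r; first exact: exprn_ge0.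
  by rewrite -natrM.
set v := #|V|%:R ^+ q; set N := n ^+ q.
have vN : v <= N by rewrite /v lerXn2r ?nnegrE // ler_nat max_card.
have G : v - 2 * theta * N <= #|Good|%:R.
  move: cover; rewrite -(ler_nat R) !natrD natrX -/v.
  move: cardL ff; rewrite -/n -/N; lra.
apply: le_trans lower.
have c0 : 0 <= (1 / 2 - theta) * n by rewrite mulr_ge0 ?(ltW n0) // subr_ge0.
apply: le_trans (ler_wpM2l c0 G); rewrite exprS -/N.
have N0 : 0 <= N by rewrite exprn_ge0 // ltW.
have h1 : theta * n * v <= theta * n * N by rewrite ler_wpM2l // mulr_ge0 // ltW.
have h2 : 0 <= theta * theta * (n * N) by rewrite !mulr_ge0 // ltW.
lra.
Qed.
End Hypotheses.

(** * The theorem over an Archimedean field *)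

Section AbstractTheorem.
Local Open Scope ring_scope.
Variables (F : finFieldType) (R : archiRealFieldType).
Local Notation q := #|F|.
Local Notation k := #|F|.+1.

Lemma few_inside_edges (eps : R) : 0 < eps < 1 ->
  exists2 theta0 : R, 0 < theta0 & forall theta : R, 0 < theta < theta0 ->
  exists n0 : nat, forall (X : finType) (H L : {set {set X}}), (n0 <= #|X|)%N ->
    (forall e, e \in H -> #|e| = k) ->
    (hom_count (PGedges F) H)%:R / (#|X| ^ (k * q).+1)%:R < theta ->
    (forall Q, Q \in L -> #|Q| = q) ->
    (forall Q : {set X}, #|Q| = q -> Q \notin L ->
      (1 / 2 - theta) * #|X|%:R <= #|nbhd H Q|%:R) ->
    (q`! * #|L|)%:R / (#|X| ^ q)%:R < theta ->
    exists A : {set X}, #|inside_edges H A|%:R <= eps * #|X|%:R ^+ k.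
Proof.
move=> /andP[eps0 eps1].
have [|t t0 tP] := @eventually_partition F R eps; first by rewrite eps0 ltW.
(* The degree sum loses [2 * theta] and may lose [t]; [theta <= 1 / 2] keeps the codegree bound
   non-negative. *)
exists (Num.min (t / 2) (1 / 2)); first by rewrite lt_min !divr_gt0.
move=> theta; rewrite lt_min => /and3P[th0 tht th2].
(* Large enough that non-injective maps are negligible; the successor makes [X] non-empty. *)
exists (Num.bound ((q ^ 2)%:R / theta)).+1 => X H L n0X uniformH homH L_q nbL cardL.
have X0 : (0 < #|X|)%N by apply: leq_trans n0X.
have Xe e : 0 < #|X|%:R ^+ e :> R by rewrite exprn_gt0 // ltr0n.
rewrite natrX ltr_pdivrMr // in homH; rewrite [X in _ / X]natrX ltr_pdivrMr // in cardL.
have nH : admissible F t H.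
  split=> // [|V].
    by apply: le_trans (ltW homH) _; rewrite ler_wpM2r ?exprn_ge0 //; lra.
  have bigX : (q ^ 2)%:R <= theta * #|X|%:R.
    rewrite mulrC -ler_pdivrMr //; apply: (@le_trans _ _ (Num.bound ((q ^ 2)%:R / theta))%:R).
      by rewrite ltW // archi_boundP // divr_ge0 // ltW.
    by rewrite ler_nat ltnW.
  apply: le_trans (sum_deg_ge uniformH V _ X0 nbL L_q (ltW cardL) bigX); last by rewrite !ltW.
  by rewrite lerD2l lerN2 ler_wpM2r ?exprn_ge0 //; lra.
have [A leA] := tP X H nH; exists A; apply: le_trans leA; exact: inside_edges_le.
Qed.

End AbstractTheorem.

(* Transfer to the real numbers *)
From Stdlib Require Import Reals.

Theorem mainTheorem12 :
  forall F : finFieldType,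
  exists eps0 : R, (0 < eps0)%R /\
  forall eps : R, (0 < eps < eps0)%R ->
  exists theta0 : R, (0 < theta0)%R /\
  forall theta : R, (0 < theta < theta0)%R ->
  exists n0 : nat,
  forall (X : finType) (H : {set {set X}}),
    (n0 <= #|X|)%N ->
    (forall e, e \in H -> #|e| = #|F|.+1) ->
    (hom_density (PGedges F) H < theta)%R ->
    (kdensity #|F| (lowdeg H #|F| theta) < theta)%R ->
    exists A : {set X},
      (INR #|inside_edges H A| <= eps * INR #|X| ^ (#|F|.+1))%R.
Proof.
move=> F; exists 1%R; split; first exact: Rlt_0_1.
move=> eps [eps0 eps1].
have [|theta0 th00 main] := @few_inside_edges F Rdefinitions.R eps.
  by apply/andP; split; apply/RltP; rewrite ?R0E ?R1E.
exists theta0; split; first exact/RltP.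
move=> theta [/RltP th_gt0 /RltP th_lt].
have [|n0 mainX] := main theta; first by apply/andP.
exists n0.+1 => X H n0X uniformH /RltP homH /RltP degH.
have [||Q cQ||A leA] := mainX X H (lowdeg H #|F| theta) (ltnW n0X) uniformH.
- by move: homH; rewrite /hom_density !RealsE card_PGpt.
- by move=> Q; rewrite inE => /andP[/eqP].
- rewrite inE cQ eqxx /=; case: Rlt_dec => [//|nlt _].
  by have /RleP := Rnot_lt_le _ _ nlt; rewrite !RealsE.
- by move: degH; rewrite /kdensity !RealsE.
by exists A; apply/RleP; move: leA; rewrite !RealsE.
Qed.
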